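(* The set of graphs without a one-way infinite bridge is nowhere dense (i) in $\mathfrak{G}^{\bullet,\infty}_{\le D}$ for every integer $D\ge 3$, and (ii) in $\mathfrak{G}^{\bullet,\infty}_{=D}$ for every odd integer $D\ge 3$.
   Context: Graphs are simple. For an integer $D\ge 3$, $\mathfrak{G}^{\bullet}_{\le D}$ is the set of connected rooted graphs $(G,x)$ of maximum degree at most $D$, up to root-preserving isomorphism. $\mathfrak{G}^{\bullet,\infty}_{\le D}$ is the subset of those with $G$ infinite, and $\mathfrak{G}^{\bullet,\infty}_{=D}$ is the subset of those with $G$ infinite and every vertex of degree exactly $D$. For $r\ge 0$, $B_r(G,x)$ is the subgraph of $G$ induced by the vertices at distance at most $r$ from $x$, rooted at $x$. The metric is $d^{\bullet}((G_1,v_1),(G_2,v_2))=\inf\{2^{-r} : B_r(G_1,v_1)\cong B_r(G_2,v_2)\}$ (root-preserving isomorphism); subsets carry the restricted metric. A subset $S$ of a space $X$ is nowhere dense in $X$ if every non-empty open $U\subseteq X$ contains a non-empty open $U'\subseteq U$ with $U'\cap S=\emptyset$. An edge $e$ of an infinite connected graph $G$ is a bridge if $G-e$ is disconnected. A bridge is two-way infinite if both components of $G-e$ are infinite, and one-way infinite otherwise. *)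

(* Defs.v *)
From HB Require Import structures.
From mathcomp Require Import all_boot all_order all_algebra generic_quotient.
From mathcomp Require Import all_classical all_reals all_analysis.

Set Implicit Arguments.
Unset Strict Implicit.
Unset Printing Implicit Defensive.

Import Order.TTheory GRing.Theory Num.Theory.
Import numFieldNormedType.Exports.

Local Open Scope classical_set_scope.
Local Open Scope card_scope.
Local Open Scope quotient_scope.

Record sgraph := SGraph {
  vertex :> Type;
  adj : rel vertex;
  adj_sym : symmetric adj;
  adj_irr : irreflexive adj }.

Record rgraph := RGraph { ugraph :> sgraph; root : ugraph }.

Definition neighbors (G : sgraph) (x : G) : set G := [set y | adj x y].

Definition dist_le (G : sgraph) (r : nat) (x y : G) : Prop :=
  exists p : seq G, [/\ path (@adj G) x p, last x p = y & (size p <= r)%N].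

Definition component (G : sgraph) (x : G) : set G :=
  [set y | exists r, dist_le r x y].

Definition connected_graph (G : sgraph) : Prop :=
  forall x y : G, component x y.

Section induced.
Context (G : sgraph) (A : set G).

(* A sig type rather than set_type: set_type is universe-monomorphic, and using
   it as the carrier of an sgraph would forbid a choiceType on graphs. *)
Definition induced_adj : rel {x : G | A x} :=
  fun x y => adj (sval x) (sval y).

Lemma induced_adj_sym : symmetric induced_adj.
Proof. by move=> x y; rewrite /induced_adj adj_sym. Qed.

Lemma induced_adj_irr : irreflexive induced_adj.
Proof. by move=> x; rewrite /induced_adj adj_irr. Qed.

Definition induced : sgraph := SGraph induced_adj_sym induced_adj_irr.

End induced.

Lemma root_ball (G : rgraph) (r : nat) : dist_le r (root G) (root G).
Proof. by exists [::]. Qed.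

Definition rball (r : nat) (G : rgraph) : rgraph :=
  @RGraph (induced [set y | dist_le r (root G) y])
          (exist _ (root G) (root_ball G r)).

Definition riso (G H : rgraph) : Prop :=
  exists f : G -> H,
    [/\ bijective f, f (root G) = root H & {mono f : x y / adj x y}].

Section delete_edge.
Context (G : sgraph) (u v : G).

Definition del_adj : rel G :=
  fun x y => adj x y && ~~ `[< [set x; y] = [set u; v] >].

Lemma del_adj_sym : symmetric del_adj.
Proof. by move=> x y; rewrite /del_adj adj_sym setUC. Qed.

Lemma del_adj_irr : irreflexive del_adj.
Proof. by move=> x; rewrite /del_adj adj_irr. Qed.

Definition del_edge : sgraph := SGraph del_adj_sym del_adj_irr.

End delete_edge.

(* The edge uv is given by its endpoints, in either order. *)
Definition bridge (G : sgraph) (u v : G) : Prop :=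
  adj u v /\ ~ connected_graph (del_edge u v).

(* When uv is a bridge of a connected graph, the component of x ranges over
   exactly the two components of the graph without uv. *)
Definition two_way_infinite (G : sgraph) (u v : G) : Prop :=
  forall x : del_edge u v, infinite_set (component x).

Definition one_way_infinite_bridge (G : sgraph) (u v : G) : Prop :=
  bridge u v /\ ~ two_way_infinite u v.

Record brgraph (D : nat) := BRGraph {
  brgraph_val :> rgraph;
  brgraph_connected : connected_graph brgraph_val;
  brgraph_degree : forall x : brgraph_val, neighbors x #<= `I_D }.

HB.instance Definition _ (D : nat) := gen_eqMixin (brgraph D).
HB.instance Definition _ (D : nat) := gen_choiceMixin (brgraph D).

Lemma riso_refl (G : rgraph) : riso G G.
Proof. by exists id; split=> //; exists id. Qed.

Lemma riso_sym (G H : rgraph) : riso G H -> riso H G.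
Proof.
move=> [f [[g fK gK] fr fa]]; exists g; split; first by exists f.
  by rewrite -fr fK.
by move=> x y; rewrite -fa !gK.
Qed.

Lemma riso_trans (G H K : rgraph) : riso G H -> riso H K -> riso G K.
Proof.
move=> [f [fb fr fa]] [g [gb gr ga]]; exists (g \o f); split.
- exact: bij_comp.
- by rewrite /= fr.
- by move=> x y; rewrite /= ga fa.
Qed.

Definition brgraph_iso (D : nat) : rel (brgraph D) := fun G H => `[< riso G H >].

Lemma brgraph_iso_refl (D : nat) : reflexive (@brgraph_iso D).
Proof. by move=> G; apply/asboolP; exact: riso_refl. Qed.

Lemma brgraph_iso_sym (D : nat) : symmetric (@brgraph_iso D).
Proof. by move=> G H; apply/asboolP/asboolP; exact: riso_sym. Qed.

Lemma brgraph_iso_trans (D : nat) : transitive (@brgraph_iso D).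
Proof.
by move=> H G K /asboolP GH /asboolP HK; apply/asboolP; exact: riso_trans GH HK.
Qed.

Canonical brgraph_iso_equiv (D : nat) :=
  EquivRel (@brgraph_iso D) (@brgraph_iso_refl D) (@brgraph_iso_sym D)
           (@brgraph_iso_trans D).

(* R is the field in which distances are measured; it is a parameter of the
   type only so that the metric structure below can be attached to it. *)
Definition rooted_graphs (R : realType) (D : nat) : Type :=
  {eq_quot @brgraph_iso D}.

HB.instance Definition _ (R : realType) (D : nat) :=
  Choice.copy (rooted_graphs R D) {eq_quot @brgraph_iso D}.

Definition iso_class (R : realType) (D : nat) (G : brgraph D) :
  rooted_graphs R D := \pi_({eq_quot @brgraph_iso D}) G.

Local Open Scope ring_scope.

Definition rgraph_dist (R : realType) (G H : rgraph) : R :=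
  inf [set 2 ^- r | r in [set r : nat | riso (rball r G) (rball r H)]].

Definition class_dist (R : realType) (D : nat) (x y : rooted_graphs R D) : R :=
  rgraph_dist R (repr (x : {eq_quot @brgraph_iso D}))
                (repr (y : {eq_quot @brgraph_iso D})).

Lemma dist_le_mono (G : sgraph) (r s : nat) (x y : G) :
  (r <= s)%N -> dist_le r x y -> dist_le s x y.
Proof. by move=> rs [p [? ? pr]]; exists p; split=> //; exact: leq_trans rs. Qed.

Lemma dist_le0 (G : sgraph) (x y : G) : dist_le 0 x y -> y = x.
Proof. by move=> [p [_ <-]]; rewrite leqn0 => /nilP ->. Qed.

Lemma dist_leS (G : sgraph) (r : nat) (x y : G) :
  dist_le r.+1 x y <-> dist_le r x y \/ exists2 z, dist_le r x z & adj z y.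
Proof.
split.
- move=> [p]; elim/last_ind: p => [|p z _] [].
    by move=> _ /= <- _; left; exists [::].
  rewrite rcons_path last_rcons size_rcons => /andP[pp lz] <- sp.
  by right; exists (last x p) => //; exists p.
- case=> [|[z [p [pp <- sp]] zy]]; first exact: dist_le_mono.
  by exists (rcons p y); rewrite rcons_path last_rcons size_rcons pp zy.
Qed.

(* f and g are total; only their values on the two balls matter. *)
Definition ball_iso (r : nat) (G H : rgraph) (f : G -> H) (g : H -> G) : Prop :=
  [/\ f (root G) = root H,
      forall x, dist_le r (root G) x -> dist_le r (root H) (f x) /\ g (f x) = x &
      forall x y, dist_le r (root G) x -> dist_le r (root G) y ->
        adj (f x) (f y) = adj x y].

Lemma riso_ball (r : nat) (G H : rgraph) : riso (rball r G) (rball r H) ->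
  exists f g, ball_iso r f g /\ @ball_iso r H G g f.
Proof.
have ext (G' H' : rgraph) (f : rball r G' -> rball r H') :
    exists f' : G' -> H', forall x, f' (sval x) = sval (f x).
  exists (fun x => if pselect (dist_le r (root G') x) is left p
    then sval (f (exist _ x p)) else root H').
  move=> [x px] /=; case: pselect => [p|np]; last by case: np.
  by rewrite (Prop_irrelevance p px).
have elt (G' : rgraph) (x : G') : dist_le r (root G') x ->
    exists x' : rball r G', x = sval x'.
  by move=> p; exists (exist _ x p).
have inb (G' : rgraph) (x : rball r G') : dist_le r (root G') (sval x).
  exact: svalP.
move=> [f [[g fK gK] fr fa]].
have [f' f'E] := ext _ _ f; have [g' g'E] := ext _ _ g.
exists f', g'; split; split.
- by rewrite -[root H]/(sval (root (rball r H))) -fr -f'E.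
- by move=> _ /elt[x ->]; rewrite f'E g'E fK; split=> //; exact: inb.
- by move=> _ _ /elt[x ->] /elt[y ->]; rewrite !f'E; exact: fa.
- by rewrite -[root G]/(sval (root (rball r G))) -[root (rball r G)]fK fr -g'E.
- by move=> _ /elt[x ->]; rewrite g'E f'E gK; split=> //; exact: inb.
- move=> _ _ /elt[x ->] /elt[y ->]; rewrite !g'E.
  by have := fa (g x) (g y); rewrite !gK => /esym.
Qed.

Lemma ball_riso (r : nat) (G H : rgraph) f g :
  @ball_iso r G H f g -> @ball_iso r H G g f -> riso (rball r G) (rball r H).
Proof.
move=> [fr fb fa] [gr gb ga].
have inb (G' : rgraph) (x : rball r G') : dist_le r (root G') (sval x).
  exact: svalP.
have sval_inj (G' : rgraph) (x y : rball r G') : sval x = sval y -> x = y.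
  move: x y => [x px] [y py] /= xy; move: px py; rewrite xy => px py.
  by rewrite (Prop_irrelevance px py).
have fP (x : rball r G) : dist_le r (root H) (f (sval x)).
  by have [] := fb _ (inb _ x).
have gP (x : rball r H) : dist_le r (root G) (g (sval x)).
  by have [] := gb _ (inb _ x).
exists (fun x => exist _ _ (fP x)); split.
- exists (fun x => exist _ _ (gP x)) => x; apply: sval_inj => /=.
    by have [] := fb _ (inb _ x).
  by have [] := gb _ (inb _ x).
- exact: sval_inj.
- by move=> x y; apply: fa; exact: inb.
Qed.

Lemma ball_iso_mono (r s : nat) (G H : rgraph) f g :
  (s <= r)%N -> @ball_iso r G H f g -> ball_iso s f g.
Proof.
move=> sr [fr fb fa]; split=> //; last first.
  by move=> x y /(dist_le_mono sr) + /(dist_le_mono sr); exact: fa.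
move=> x xs; split; last by have [] := fb _ (dist_le_mono sr xs).
elim: s sr x xs => [|s IH] sr x.
  by move=> /dist_le0 ->; rewrite fr; exact: root_ball.
move=> /dist_leS[xs|[z zs zx]].
  by apply: (@dist_le_mono _ s) => //; apply: IH => //; exact: ltnW.
apply/dist_leS; right; exists (f z); first by apply: IH => //; exact: ltnW.
rewrite fa //; first by apply: dist_le_mono zs; exact: ltnW.
by apply: (dist_le_mono sr); apply/dist_leS; right; exists z.
Qed.

Lemma riso_rball_mono (r s : nat) (G H : rgraph) : (s <= r)%N ->
  riso (rball r G) (rball r H) -> riso (rball s G) (rball s H).
Proof.
move=> sr /riso_ball[f [g [fP gP]]].
exact: ball_riso (ball_iso_mono sr fP) (ball_iso_mono sr gP).
Qed.

Lemma dist_le_morph (r : nat) (G H : sgraph) (f : G -> H) x y :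
  {mono f : x y / adj x y} -> dist_le r x y -> dist_le r (f x) (f y).
Proof.
move=> fa [p [pp <- sp]]; exists [seq f z | z <- p].
rewrite last_map size_map; split=> //.
by rewrite path_map; apply: sub_path pp => a b /=; rewrite fa.
Qed.

Lemma riso_rball (r : nat) (G H : rgraph) :
  riso G H -> riso (rball r G) (rball r H).
Proof.
move=> [f [[g fK gK] fr fa]].
have ga : {mono g : x y / adj x y} by move=> x y; rewrite -fa !gK.
have gr : g (root H) = root G by rewrite -fr fK.
apply: (@ball_riso r G H f g); split=> //.
- by move=> x xr; rewrite fK -fr; split=> //; exact: dist_le_morph.
- by move=> x xr; rewrite gK -gr; split=> //; exact: dist_le_morph.
Qed.

Lemma finite_ball (D : nat) (G : brgraph D) (r : nat) (x : G) :
  finite_set [set y | dist_le r x y].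
Proof.
elim: r => [|r IH].
  apply: (sub_finite_set (B := [set x])); last exact: finite_set1.
  by move=> y /dist_le0 ->.
apply: (sub_finite_set
  (B := [set y | dist_le r x y] `|`
        \bigcup_(z in [set z | dist_le r x z]) neighbors z)).
  by move=> y /dist_leS[|[z zr zy]]; [left|right; exists z].
rewrite finite_setU; split=> //; apply: bigcup_finite => // z _.
by apply: card_le_finite (brgraph_degree z) _; exact: finite_II.
Qed.

Lemma ultra_finite (T V : Type) (F : set_system T) (FU : UltraFilter F)
    (A : set V) (h : T -> V) :
  finite_set A -> F [set t | A (h t)] -> exists v, F [set t | h t = v].
Proof.
move=> /finite_setP[n]; elim: n A => [|n IH] A.
  rewrite II0 card_eq0 => /eqP ->; set B := (X in F X) => FB.
  by have [] := filter_ex FB.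
move=> /eq_cardSP[v Av /IH{}IH] FA.
have [Fv|Fv] := in_ultra_setVsetC [set t | h t = v] FU; first by exists v.
by apply: IH; near=> t; split; near: t.
Unshelve. all: by end_near. Qed.

Lemma riso_all_balls (D : nat) (G H : brgraph D) :
  (forall r, riso (rball r G) (rball r H)) -> riso G H.
Proof.
move=> iso.
have /boolp.choice[fg fgP] : forall r, exists fg : (G -> H) * (H -> G),
    ball_iso r fg.1 fg.2 /\ @ball_iso r H G fg.2 fg.1.
  by move=> r; have [f [g ?]] := riso_ball (iso r); exists (f, g).
have [U [UU sU]] := ultraFilterLemma (F := \oo) _.
have nearU (n : nat) : U [set r | (n <= r)%N] by apply: sU; exact: nbhs_infty_ge.
have lim (K L : brgraph D) (h : nat -> K -> L) :
    (forall r x, dist_le r (root K) x -> forall s, (r <= s)%N ->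
       dist_le r (root L) (h s x)) ->
    exists h', forall x, U [set r | h r x = h' x].
  move=> hP; suff /boolp.choice[h' h'P] :
    forall x, exists y, U [set r | h r x = y] by exists h'.
  move=> x.
  have [r xr] := brgraph_connected (root K) x.
  apply: (ultra_finite (h := h ^~ x) UU (finite_ball r (root L))).
  by apply: filterS (nearU r) => s; exact: hP.
have [f fP] : exists f : G -> H, forall x, U [set r | (fg r).1 x = f x].
  apply: lim => r x xr s rs.
  by have [/(ball_iso_mono rs)[_ /(_ _ xr)[]]] := fgP s.
have [g gP] : exists g : H -> G, forall x, U [set r | (fg r).2 x = g x].
  apply: lim => r x xr s rs.
  by have [_ /(ball_iso_mono rs)[_ /(_ _ xr)[]]] := fgP s.
have UF : ProperFilter U by exact: ultra_proper.
have inb (K : brgraph D) (x : K) : U [set r | dist_le r (root K) x].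
  have [r xr] := brgraph_connected (root K) x.
  by apply: filterS (nearU r) => s rs; exact: dist_le_mono xr.
exists f; split.
- exists g => x.
    have [r [[/= rx fx] /= gx]] := filter_ex
      (filterI (filterI (inb _ x) (fP x)) (gP (f x))).
    have [[_ /(_ _ rx)[_ gf] _] _] := fgP r.
    by rewrite -gx -fx.
  have [r [[/= rx gx] /= fx]] := filter_ex
    (filterI (filterI (inb _ x) (gP x)) (fP (g x))).
  have [_ [_ /(_ _ rx)[_ fg'] _]] := fgP r.
  by rewrite -fx -gx.
- have [r /= <-] := filter_ex (fP (root G)).
  by have [[]] := fgP r.
- move=> x y.
  have [r [[/= rx fx] [/= ry fy]]] := filter_ex
    (filterI (filterI (inb _ x) (fP x)) (filterI (inb _ y) (fP y))).
  by have [[_ _ /(_ _ _ rx ry)]] := fgP r; rewrite fx fy.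
Qed.

Section rgraph_dist_theory.
Context (R : realType) (D : nat).
Implicit Types G H K : brgraph D.

Let P G H := [set r : nat | riso (rball r G) (rball r H)].

Let P0 G H : P G H 0%N.
Proof.
apply: (@ball_riso 0 G H (fun=> root H) (fun=> root G)); split=> //.
- by move=> x /dist_le0 ->; split=> //; exact: root_ball.
- by move=> x y /dist_le0 -> /dist_le0 ->; rewrite !adj_irr.
- by move=> x /dist_le0 ->; split=> //; exact: root_ball.
- by move=> x y /dist_le0 -> /dist_le0 ->; rewrite !adj_irr.
Qed.

Let expr2V_gt0 (r : nat) : 0 < 2 ^- r :> R.
Proof. by rewrite invr_gt0 exprn_gt0. Qed.

Let dist_has_inf G H : has_inf [set (2 ^- r : R) | r in P G H].
Proof.
split; first by exists 1, 0%N; [exact: P0|rewrite expr0 invr1].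
by exists 0 => _ [r _ <-]; exact: ltW.
Qed.

Let dist_le_pow G H r : P G H r -> rgraph_dist R G H <= 2 ^- r.
Proof.
by move=> Pr; apply: ge_inf; [have [] := dist_has_inf G H|exists r].
Qed.

Let le_dist G H a : (forall r, P G H r -> a <= 2 ^- r) -> a <= rgraph_dist R G H.
Proof.
move=> aP; apply: lb_le_inf; first by have [] := dist_has_inf G H.
by move=> _ [r Pr <-]; exact: aP.
Qed.

Lemma rgraph_distxx G : rgraph_dist R G G = 0.
Proof.
apply/eqP; rewrite eq_le le_dist ?andbT; last by move=> r _; exact: ltW.
apply/ler_addgt0Pl => e e0; rewrite addr0.
have [r re] : exists r : nat, 2 ^- r < e.
  exists (Num.truncn e^-1).+1.
  rewrite invf_plt ?posrE ?exprn_gt0//.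
  apply: (lt_trans (truncnS_gt _)).
  by rewrite -natrX ltr_nat ltn_expl.
by apply: le_trans (ltW re); apply: dist_le_pow; exact: riso_refl.
Qed.

Lemma rgraph_dist_eq0 G H : rgraph_dist R G H = 0 -> riso G H.
Proof.
move=> GH0; apply: riso_all_balls => r.
have [_ [s Ps <-]] := inf_adherent (expr2V_gt0 r) (dist_has_inf G H).
rewrite [inf _]GH0 add0r ltf_pV2 ?posrE ?exprn_gt0// ltr_eXn2l ?ltr1n// => rs.
by apply: riso_rball_mono Ps; exact: ltnW.
Qed.

Lemma rgraph_dist_sym G H : rgraph_dist R G H = rgraph_dist R H G.
Proof.
rewrite /rgraph_dist; congr (inf (image _ _)); apply/seteqP.
by split=> r /=; exact: riso_sym.
Qed.

Lemma rgraph_dist_triangle H G K :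
  rgraph_dist R G K <= rgraph_dist R G H + rgraph_dist R H K.
Proof.
rewrite -lerBlDr; apply: le_dist => r Pr.
rewrite lerBlDr -lerBlDl; apply: le_dist => s Ps.
rewrite lerBlDl; apply: (@le_trans _ _ (2 ^- minn r s)).
  apply: dist_le_pow; apply: (riso_trans (H := rball (minn r s) H)).
    by apply: riso_rball_mono Pr; exact: geq_minl.
  by apply: riso_rball_mono Ps; exact: geq_minr.
by rewrite /minn; case: ifP => _; rewrite ?lerDl ?lerDr ltW.
Qed.

Lemma rgraph_dist_riso G G' H H' : riso G G' -> riso H H' ->
  rgraph_dist R G H = rgraph_dist R G' H'.
Proof.
move=> GG' HH'; rewrite /rgraph_dist; congr (inf (image _ _)); apply/seteqP.
split=> r /= Pr.
- apply: riso_trans (riso_rball r HH').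
  by apply: riso_trans Pr; apply: riso_rball; exact: riso_sym.
- apply: riso_trans (riso_rball r (riso_sym HH')).
  by apply: riso_trans Pr; exact: riso_rball.
Qed.

Local Notation Q := {eq_quot @brgraph_iso D}.

Lemma iso_class_eq G H : iso_class R G = iso_class R H <-> riso G H.
Proof.
split=> [/eqmodP/asboolP//|GH].
by apply/eqmodP; exact/asboolP.
Qed.

Lemma class_dist_iso_class G H :
  class_dist (iso_class R G) (iso_class R H) = rgraph_dist R G H.
Proof.
have reprP K : riso (repr (\pi_Q K)) K.
  by apply/iso_class_eq; rewrite /iso_class reprK.
apply: rgraph_dist_riso; exact: reprP.
Qed.

Lemma class_distxx (x : rooted_graphs R D) : class_dist x x = 0.
Proof. exact: rgraph_distxx. Qed.

Lemma class_dist_eq0 (x y : rooted_graphs R D) : class_dist x y = 0 -> x = y.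
Proof.
move=> /rgraph_dist_eq0/iso_class_eq.
by rewrite /iso_class !reprK.
Qed.

Lemma class_dist_sym (x y : rooted_graphs R D) : class_dist x y = class_dist y x.
Proof. exact: rgraph_dist_sym. Qed.

Lemma class_dist_triangle (y x z : rooted_graphs R D) :
  class_dist x z <= class_dist x y + class_dist y z.
Proof. exact: rgraph_dist_triangle. Qed.

End rgraph_dist_theory.

HB.instance Definition _ (R : realType) (D : nat) :=
  @isMetric.Build R (rooted_graphs R D) (@class_dist R D) (@class_distxx R D)
    (@class_dist_eq0 R D) (@class_dist_sym R D) (@class_dist_triangle R D).

(* As subtypes of rooted_graphs, the two sets below carry the restricted metric
   through the library's subtype instances on set_type. *)
Definition infinite_graphs (R : realType) (D : nat) : set (rooted_graphs R D) :=
  [set iso_class R G | G in [set G : brgraph D | infinite_set [set: G]]].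
Arguments infinite_graphs : clear implicits.

Definition regular_infinite_graphs (R : realType) (D : nat) :
    set (rooted_graphs R D) :=
  [set iso_class R G | G in [set G : brgraph D |
    infinite_set [set: G] /\ forall x : G, neighbors x #= `I_D]].
Arguments regular_infinite_graphs : clear implicits.

Definition no_one_way_infinite_bridge (R : realType) (D : nat) :
    set (rooted_graphs R D) :=
  [set iso_class R G | G in [set G : brgraph D |
    ~ exists u v : G, one_way_infinite_bridge u v]].
Arguments no_one_way_infinite_bridge : clear implicits.

Definition nowhere_dense (X : topologicalType) (S : set X) : Prop :=
  forall U : set X, open U -> U !=set0 ->
    exists U' : set X, [/\ open U', U' !=set0, U' `<=` U & U' `&` S = set0].

(* Main.v *)
(** Far from the root of an infinite graph [G], subdivide an edge [uw] by a new
    vertex [m], and hang at [m] a finite graph by a bridge: this changes no ball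
    of small radius. In the bounded-degree case a single vertex is hung at [m].
    In the regular case of odd degree [D], [D - 2] copies of a finite graph are
    hung, in which all degrees are [D] except for one vertex of degree [D - 1],
    joined to [m]; such a graph exists on [D + 2] vertices. A ball that contains
    the finite side of the bridge together with its neighbours determines that
    the edge is a one-way infinite bridge, so every graph close enough to the
    modified one also has such a bridge. *)

Require Import Defs.
From mathcomp Require Import all_boot all_order all_algebra.
From mathcomp Require Import all_classical all_reals all_analysis.

Set Implicit Arguments.
Unset Strict Implicit.
Unset Printing Implicit Defensive.

Import Order.TTheory GRing.Theory Num.Theory.
Import numFieldNormedType.Exports.

Local Open Scope classical_set_scope.
Local Open Scope card_scope.

(** * Components and connectedness *)

Lemma component_refl (G : sgraph) (x : G) : component x x.
Proof. by exists 0, [::]. Qed.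

Lemma component_adj (G : sgraph) (x y : G) : adj x y -> component x y.
Proof. by move=> xy; exists 1, [:: y]; rewrite /= xy. Qed.

Lemma component_trans (G : sgraph) (y x z : G) :
  component x y -> component y z -> component x z.
Proof.
move=> [m [p [xp <- _]]] [n [q [yq <- _]]]; exists (size (p ++ q)), (p ++ q).
by rewrite cat_path xp yq last_cat.
Qed.

Lemma component_ind (G : sgraph) (x : G) (P : set G) : P x ->
  (forall y z, P y -> adj y z -> P z) -> component x `<=` P.
Proof.
move=> Px step y [r]; elim: r y => [|r IH] y; first by move=> /dist_le0 ->.
by move=> /dist_leS[/IH//|[z /IH Pz zy]]; exact: step zy.
Qed.

Lemma component_sym (G : sgraph) (x y : G) : component x y -> component y x.
Proof.
move: y; apply: component_ind; first exact: component_refl.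
move=> y z yx yz; apply: component_trans yx.
by apply: component_adj; rewrite adj_sym.
Qed.

Lemma connected_root (G : sgraph) (x : G) :
  (forall y, component x y) -> connected_graph G.
Proof.
by move=> xG y z; apply: component_trans (xG z); exact: component_sym.
Qed.

(** Provides the radius at which a ball sees the whole finite side of a bridge. *)
Lemma finite_le_dist (G : sgraph) (x : G) (F : set G) :
  connected_graph G -> finite_set F ->
  exists r, forall y, F y -> dist_le r x y.
Proof.
move=> Gc /finite_setP[n]; elim: n F => [|n IH] F.
  by rewrite II0 card_eq0 => /eqP ->; exists 0.
move=> /eq_cardSP[y Fy /IH[r Fr]]; have [s xy] := Gc x y.
exists (maxn r s) => z Fz; have [->|zy] := EM (z = y).
  by apply: dist_le_mono xy; exact: leq_maxr.
by apply: dist_le_mono (Fr z _) => //; exact: leq_maxl.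
Qed.

(** * Detecting a one-way infinite bridge inside a ball *)

(** Once [ab] is deleted, no edge leaves [F], so the component of [a] stays in [F]: it misses [b],
    and it is finite. *)
Lemma one_way_infinite_bridge_cut (G : sgraph) (F : set G) (a b : G) :
  finite_set F -> F a -> ~ F b -> adj a b ->
  (forall x y, F x -> adj x y -> F y \/ x = a /\ y = b) ->
  one_way_infinite_bridge a b.
Proof.
move=> Ffin Fa Fb ab cut.
have sub : @component (del_edge a b) a `<=` F.
  apply: component_ind => // y z Fy /andP[yz /asboolPn ne].
  by have [//|[ya zb]] := cut _ _ Fy yz; case: ne; rewrite ya zb.
split; last by move=> /(_ a); apply; exact: sub_finite_set sub Ffin.
by split=> // /(_ a b)/sub.
Qed.

Lemma one_way_infinite_bridge_local (H K : Defs.rgraph) (s : nat) (F : set H)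
    (a b : H) :
  finite_set F -> F a -> ~ F b -> adj a b ->
  (forall x y, F x -> adj x y -> F y \/ x = a /\ y = b) ->
  (forall x, F x -> dist_le s (Defs.root H) x) ->
  riso (rball s.+1 H) (rball s.+1 K) ->
  exists u v : K, one_way_infinite_bridge u v.
Proof.
move=> Ffin Fa Fb ab cut Fs /riso_ball[f [g [[fr fP fa] [_ gP _]]]].
have inF x : F x -> dist_le s.+1 (Defs.root H) x.
  by move=> /Fs; exact: dist_le_mono.
have inN x y : F x -> adj x y -> dist_le s.+1 (Defs.root H) y.
  by move=> Fx xy; apply/dist_leS; right; exists x => //; exact: Fs.
(* Restricting to radius [s] keeps the image of [F] one step inside the ball, so that [g] pulls back
   every neighbour of that image. *)
have inK x : F x -> dist_le s (Defs.root K) (f x).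
  have [_ sP _] : @ball_iso s H K f g by exact: (@ball_iso_mono s.+1).
  by move=> /Fs/sP[].
exists (f a), (f b); apply: (@one_way_infinite_bridge_cut _ (f @` F)).
- exact: finite_image.
- by exists a.
- move=> [x Fx /(congr1 g)].
  rewrite (fP _ (inF _ Fx)).2 (fP _ (inN _ _ Fa ab)).2 => xb.
  by rewrite -xb in Fb.
- by rewrite fa //; [exact: inF|exact: inN Fa ab].
- move=> _ y [x Fx <-] xy.
  have yK : dist_le s.+1 (Defs.root K) y.
    by apply/dist_leS; right; exists (f x) => //; exact: inK.
  have [gy fgy] := gP _ yK.
  rewrite -fgy fa // in xy; last exact: inF.
  by have [Fy|[-> <-]] := cut _ _ Fx xy; [left; exists (g y)|right].
Qed.

(** Balls are finite, so some vertex is farther than [r.+1] from the root; its predecessor on a path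
    from the root is then farther than [r]. *)
Lemma far_edge (D : nat) (G : brgraph D) (r : nat) : infinite_set [set: G] ->
  exists u w : G,
    [/\ adj u w, ~ dist_le r (Defs.root G) u & ~ dist_le r (Defs.root G) w].
Proof.
move=> Ginf; have [y yr] : exists y, ~ dist_le r.+1 (Defs.root G) y.
  apply: contrapT => /forallNP h; apply: Ginf.
  apply: sub_finite_set (finite_ball r.+1 (Defs.root G)) => y _.
  by apply: contrapT; exact: h.
have [n] := brgraph_connected (Defs.root G) y.
elim: n => [/dist_le0 yE|n IH /dist_leS[/IH//|[z _ zy]]].
  by case: yr; rewrite yE; apply: (dist_le_mono (leq0n _)); exact: root_ball.
exists z, y; split=> //; last by move=> /(dist_le_mono (leqnSn r)).
by move=> zr; apply: yr; apply/dist_leS; right; exists z.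
Qed.

(** * Finite types: cardinals of images, and copies in [Set] *)

Lemma card_image_finset (T : finType) (U : Type) (f : T -> U) (A : {set T}) :
  injective f -> f @` [set` A] #= `I_#|A|.
Proof.
move=> fI; apply: (card_eq_trans (inj_card_eq _)); first by move=> x y _ _ /fI.
have -> : [set` A] = (enum_val : 'I_#|A| -> T) @` [set: 'I_#|A|].
  apply/seteqP; split=> [x /= xA|_ [i _ <-]]; last exact: enum_valP.
  by exists (enum_rank_in xA x) => //; rewrite enum_rankK_in.
apply: (card_eq_trans (inj_card_eq _)); first by move=> x y _ _ /enum_val_inj.
by rewrite card_eq_sym; exact: card_II.
Qed.

(* A copy of [T] in [Set]: the universe of [T] itself may be too large for the
   vertices of an [sgraph]. *)
Definition small (T : finType) : Set := {i : nat | (i < #|T|)%N}.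

Definition to_small (T : finType) (a : T) : small T :=
  exist _ (enum_rank a : nat) (ltn_ord (enum_rank a)).

Definition of_small (T : finType) (s : small T) : T :=
  enum_val (Ordinal (svalP s)).

Lemma to_smallK (T : finType) : cancel (@to_small T) (@of_small T).
Proof.
by move=> a; rewrite /of_small -[RHS]enum_rankK; congr enum_val; exact: val_inj.
Qed.

Lemma of_smallK (T : finType) : cancel (@of_small T) (@to_small T).
Proof.
move=> s; apply: eq_sig_hprop; first by move=> i; exact: bool_irrelevance.
by rewrite /= enum_valK.
Qed.

(** * Grafting a finite graph into an edge *)

(* [G] with the edge [uw] replaced by a path [u - m - w] through the vertex [m]
   of a finite graph [T]. Both endpoints of an edge satisfy [is_end] only if the
   edge is [uw]. *)
Section graft.
Context (G : sgraph) (u w : G) (T : finType) (adjT : rel T) (m : T).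
Hypotheses (symT : symmetric adjT) (irrT : irreflexive adjT) (uw : adj u w).

Definition is_end (x : G) : bool := `[< x = u \/ x = w >].

Definition graft_adj : rel (G + small T) := fun x y =>
  match x, y with
  | inl x, inl y => adj x y && ~~ (is_end x && is_end y)
  | inl x, inr s | inr s, inl x => is_end x && (of_small s == m)
  | inr s, inr t => adjT (of_small s) (of_small t)
  end.

Lemma graft_adj_sym : symmetric graft_adj.
Proof.
by move=> [x|s] [y|t] //=; rewrite adj_sym [is_end x && _]andbC.
Qed.

Lemma graft_adj_irr : irreflexive graft_adj.
Proof. by move=> [x|s] /=; rewrite ?adj_irr ?irrT. Qed.

Definition graft : sgraph := SGraph graft_adj_sym graft_adj_irr.

Definition graft_new (a : T) : graft := inr (to_small a).

Lemma graftP (P : graft -> Prop) :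
  (forall x, P (inl x)) -> (forall a, P (graft_new a)) -> forall x, P x.
Proof. by move=> Po Pn [x //|s]; rewrite -[s]of_smallK; exact: Pn. Qed.

Lemma adj_graft_new (a b : T) : adj (graft_new a) (graft_new b) = adjT a b.
Proof. by rewrite /adj /= !to_smallK. Qed.

Lemma adj_graft_old_new (x : G) (a : T) :
  adj (inl x : graft) (graft_new a) = is_end x && (a == m).
Proof. by rewrite /adj /= to_smallK. Qed.

Lemma graft_new_inj : injective graft_new.
Proof. by move=> a b [/val_inj/enum_rank_inj]. Qed.

Lemma graft_infinite : infinite_set [set: G] -> infinite_set [set: graft].
Proof.
move=> Ginf Hfin; apply: Ginf.
apply: sub_finite_set
  (finite_image (fun y => if y is inl x then x else u) Hfin).
by move=> x _; exists (inl x).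
Qed.

Lemma is_endl : is_end u. Proof. by apply/asboolP; left. Qed.

Lemma is_endr : is_end w. Proof. by apply/asboolP; right. Qed.

(** By irreflexivity, the only possible neighbour of an end among the ends is the other one. This
    makes the map [f] of [neighbors_graft_old] injective. *)
Lemma is_end_uniq x y z : is_end x -> is_end y -> is_end z ->
  adj x y -> adj x z -> y = z.
Proof.
by move=> /asboolP[->|->] /asboolP[->|->] /asboolP[->|->]; rewrite ?adj_irr.
Qed.

(** Edges of [G] survive, except one between two ends, which is replaced by a detour through [m]. *)
Lemma graft_connected : connected_graph G ->
  (forall a, connect adjT m a) -> connected_graph graft.
Proof.
move=> Gc Tc; apply: (@connected_root _ (graft_new m)); apply: graftP => [x|a].
- apply: (component_trans (y := (inl u : graft))).
    by apply: component_adj; rewrite adj_sym adj_graft_old_new is_endl eqxx.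
  have := Gc u x; move: x.
  apply: component_ind; first exact: component_refl.
  move=> y z uy yz; apply: (component_trans uy).
  have [/andP[ye ze]|ne] := boolP (is_end y && is_end z).
    apply: (component_trans (y := graft_new m)); apply: component_adj.
      by rewrite adj_graft_old_new ye eqxx.
    by rewrite adj_sym adj_graft_old_new ze eqxx.
  by apply: component_adj; rewrite /adj /= yz ne.
- have /connectP[p + ->] := Tc a.
  elim: p m => [|b p IH] c /=; first by move=> _; exact: component_refl.
  move=> /andP[cb /IH]; apply: component_trans.
  by apply: component_adj; rewrite adj_graft_new.
Qed.

(** Each end loses the other end as a neighbour and gains [m]; the map [f] makes this exchange. *)
Lemma neighbors_graft_old (x : G) : neighbors (inl x : graft) #= neighbors x.
Proof.
pose f (y : G) : graft :=
  if is_end x && is_end y then graft_new m else inl y.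
have -> : neighbors (inl x : graft) = f @` neighbors x.
  apply/seteqP; split=> [|_ [y xy <-]].
    apply: graftP => [y /andP[xy ne]|a].
      by exists y => //; rewrite /f (negbTE ne).
    rewrite /neighbors /mkset adj_graft_old_new => /andP[xe /eqP ->].
    have [xu|xw] : x = u \/ x = w by move: xe => /asboolP.
      by exists w; rewrite ?xu// /f xe is_endr.
    by exists u; rewrite 1?adj_sym ?xw// /f xe is_endl.
  rewrite /neighbors /mkset /f.
  have [/andP[xe _]|ne] := boolP (is_end x && is_end y).
    by rewrite adj_graft_old_new xe eqxx.
  by rewrite /adj /= ne andbT.
apply: inj_card_eq => y z /set_mem xy /set_mem xz; rewrite /f.
case: ifPn => [/andP[xe ye]|_]; case: ifPn => [/andP[_ ze]|_] //.
  by move=> _; exact: is_end_uniq xy xz.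
by move=> [].
Qed.

Lemma neighbors_graft_new (a : T) :
  neighbors (graft_new a) #= `I_(#|[set b | adjT a b]%SET| + (a == m).*2).
Proof.
(* The summand [bool] encodes the two ends, so that the neighbours become the image of a finite set
   that can be counted. *)
pose f (z : bool + T) : graft := match z with
  | inl b => inl (if b then u else w)
  | inr b => graft_new b end.
pose A : {set bool + T} :=
  if a == m then inl @: [set: bool]%SET else finset.set0.
pose B : {set bool + T} := inr @: [set b | adjT a b]%SET.
have -> : neighbors (graft_new a) = f @` [set` (A :|: B)%SET].
  apply/seteqP; split.
    apply: graftP => [x|b]; rewrite /neighbors /mkset.
      rewrite adj_sym adj_graft_old_new => /andP[/asboolP xe am].
      case: xe => ->; [exists (inl true)|exists (inl false)] => //=;
        by rewrite inE /A am imset_f ?inE.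
    rewrite adj_graft_new => ab; exists (inr b) => //=.
    by rewrite !inE imset_f ?inE ?orbT.
  move=> _ [z /= zAB <-]; move: zAB; rewrite inE /neighbors /mkset => /orP[].
    rewrite /A; case: ifP => [am|_]; last by rewrite inE.
    move=> /imsetP[b _ ->]; rewrite adj_sym -[f _]/(inl _) adj_graft_old_new am.
    by rewrite andbT; case: b; [exact: is_endl|exact: is_endr].
  by move=> /imsetP[b + ->]; rewrite inE -[f _]/(graft_new b) adj_graft_new.
have -> : (#|[set b | adjT a b]%SET| + (a == m).*2)%N = #|(A :|: B)%SET|.
  have cB : #|B| = #|[set b | adjT a b]%SET| by apply: card_imset => ? ? [].
  rewrite cardsU (_ : (A :&: B)%SET = finset.set0) ?cards0 ?subn0.
    rewrite cB addnC /A; case: ifP => _; rewrite ?cards0//.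
    by rewrite card_imset ?cardsT ?card_bool// => ? ? [].
  apply/setP => z; rewrite !inE /A; case: ifP => _; rewrite ?inE//.
  by apply/andP => -[/imsetP[b _ ->]] /imsetP[].
have nuw : u <> w by move=> e; move: uw; rewrite e adj_irr.
apply: card_image_finset => -[[]|b] [[]|c] //=.
- by move=> [/nuw].
- by move=> [/esym/nuw].
- by move=> /graft_new_inj ->.
Qed.

End graft.

Lemma riso_rball_graft (G : Defs.rgraph) (u w : G) (T : finType)
    (adjT : rel T) (m : T) (symT : symmetric adjT) (irrT : irreflexive adjT)
    (r : nat) :
  ~ dist_le r (Defs.root G) u -> ~ dist_le r (Defs.root G) w ->
  riso (rball r G)
       (rball r (@RGraph (graft u w m symT irrT) (inl (Defs.root G)))).
Proof.
set x0 := Defs.root G; set H := graft u w m symT irrT.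
move=> ru rw.
have far x : dist_le r x0 x -> is_end u w x = false.
  by move=> xr; apply/asboolPn => -[] xe; rewrite xe in xr.
have old n x : (n <= r)%N -> dist_le n x0 x ->
    @dist_le H n (inl x0) (inl x).
  elim: n x => [|n IH] x nr; first by move=> /dist_le0 ->; exists [::].
  move=> /dist_leS[xn|[z zn zx]]; apply/dist_leS.
    by left; apply: IH => //; exact: ltnW.
  right; exists (inl z); first by apply: IH => //; exact: ltnW.
  by rewrite /adj /= zx far//; apply: dist_le_mono zn; exact: ltnW.
have old_inv n y : (n <= r)%N -> @dist_le H n (inl x0) y ->
    exists2 x, y = inl x & dist_le n x0 x.
  elim: n y => [|n IH] y nr.
    by move=> /dist_le0 ->; exists x0 => //; exists [::].
  move=> /dist_leS[/IH[|x -> xn]|[z /IH[|x -> xn]]]; do ?exact: ltnW.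
    by exists x => //; apply/dist_leS; left.
  have xe : is_end u w x = false.
    by apply: far; apply: dist_le_mono xn; exact: ltnW.
  case: y => [y|s]; rewrite /adj /= xe ?andbF //= andbT => xy.
  by exists y => //; apply/dist_leS; right; exists x.
(* The value [u] at new vertices is arbitrary: by [old_inv] the ball contains none of them. *)
apply: (@ball_riso r G (@RGraph H (inl x0)) (inl : G -> H)
  (fun y : H => if y is inl x then x else u)).
  split=> //= [x xr|x y xr yr]; first by split=> //; exact: old.
  by rewrite /adj /= far ?andbT.
split=> //= [_ /old_inv[//|x -> xr] //|].
move=> _ _ /old_inv[//|x -> xr] /old_inv[//|y -> yr].
by rewrite /adj /= far ?andbT.
Qed.


(** Common core of both cases: [F] is the finite side of the bridge [ab]. As [m] is outside [F], no
    vertex of [F] is joined to [G]. The term [(c == m).*2] reserves room at [m] for the ends of the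
    subdivided edge. *)
Lemma graft_approx (D r : nat) (G : brgraph D) (T : finType) (adjT : rel T)
    (m a b : T) (F : {set T}) :
  symmetric adjT -> irreflexive adjT -> (forall c, connect adjT m c) ->
  a \in F -> b \notin F -> m \notin F -> adjT a b ->
  (forall c d, c \in F -> adjT c d -> d \in F \/ c = a /\ d = b) ->
  (forall c, #|[set d | adjT c d]%SET| + (c == m).*2 <= D)%N ->
  infinite_set [set: G] ->
  exists H : brgraph D, [/\ infinite_set [set: H],
    (forall x : G, neighbors x #= `I_D) ->
      (forall c, #|[set d | adjT c d]%SET| + (c == m).*2 = D)%N ->
      forall x : H, neighbors x #= `I_D,
    riso (rball r G) (rball r H) &
    exists s, forall K : brgraph D, riso (rball s H) (rball s K) ->
      exists u v : K, one_way_infinite_bridge u v].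
Proof.
move=> symT irrT Tc aF bF mF ab cut degT Ginf.
have [u [w [uw ru rw]]] := far_edge r Ginf.
pose H0 := graft u w m symT irrT.
have H0c : connected_graph H0.
  exact: graft_connected (@brgraph_connected _ G) Tc.
have H0deg (x : H0) : neighbors x #<= `I_D.
  move: x; apply: graftP => [x|c].
    rewrite (card_le_eql (neighbors_graft_old m symT irrT uw x)).
    exact: brgraph_degree.
  by rewrite (card_le_eql (neighbors_graft_new m symT irrT uw c)) card_le_II.
pose H := @BRGraph D (@RGraph H0 (inl (Defs.root G))) H0c H0deg.
exists H; split.
- exact: graft_infinite.
- move=> Greg Treg; apply: graftP => [x|c].
    exact: card_eq_trans (neighbors_graft_old m symT irrT uw x) (Greg x).
  by rewrite -[X in `I_X](Treg c); exact: neighbors_graft_new.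
- exact: riso_rball_graft.
pose new := graft_new u w m symT irrT.
pose F' : set H := new @` [set` F].
have newF c : F' (new c) -> c \in F.
  by move=> [d dF /graft_new_inj <-].
have Ffin : finite_set F' by exact: finite_image.
have [s Fs] := finite_le_dist (Defs.root H) H0c Ffin.
exists s.+1 => K; apply: one_way_infinite_bridge_local Fs.
- exact: Ffin.
- by exists a.
- by move=> /newF; apply/negP; exact: bF.
- by rewrite -[adj _ _]/(adj (new a) (new b)) adj_graft_new.
- move=> _ y [c cF <-]; move: y; apply: graftP => [x|d].
    rewrite adj_sym adj_graft_old_new => /andP[_ /eqP cm].
    by rewrite -cm cF in mF.
  rewrite adj_graft_new => /cut[//|dF|[-> ->]]; last by right.
  by left; exists d.
Qed.

(** * From balls of graphs to the metric topology *)

Local Open Scope ring_scope.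

Lemma rgraph_dist_lt (R : realType) (D r : nat) (G H : brgraph D) :
  rgraph_dist R G H < 2 ^- r -> riso (rball r G) (rball r H).
Proof.
rewrite /rgraph_dist; set A := image _ _ => GH.
(* The infimum of the empty set is [0] by convention, so that case would mean distance [0], hence
   isomorphic graphs. *)
have [A0|/set0P Ane] := eqVneq A set0.
  apply: riso_rball; apply: (@rgraph_dist_eq0 R).
  by rewrite /rgraph_dist -/A A0 inf0.
have [_ [s Gs <-]] := inf_lt Ane GH.
rewrite ltf_pV2 ?posrE ?exprn_gt0// ltr_eXn2l ?ltr1n// => rs.
exact: riso_rball_mono (ltnW rs) Gs.
Qed.

Lemma exp2V_lt (R : realType) (e : R) : 0 < e -> exists r : nat, 2 ^- r < e.
Proof.
move=> e0; exists (Num.truncn e^-1).+1.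
rewrite invf_plt ?posrE ?exprn_gt0//.
by apply: (lt_trans (truncnS_gt _)); rewrite -natrX ltr_nat ltn_expl.
Qed.

(** Graphs at distance less than [2 ^- s] from [H] share its ball of radius [s], hence have a
    one-way infinite bridge; a neighbourhood of [H] thus avoids the set. *)
Lemma nowhere_dense_iso_class (R : realType) (D : nat) (P : set (brgraph D)) :
  (forall (G : brgraph D) (r : nat), P G -> exists H : brgraph D,
    [/\ P H, riso (rball r G) (rball r H) &
      exists s, forall K : brgraph D, riso (rball s H) (rball s K) ->
        exists u v : K, one_way_infinite_bridge u v]) ->
  @nowhere_dense ([set iso_class R G | G in P] : set (rooted_graphs R D))
    [set x | no_one_way_infinite_bridge R D (\val x)].
Proof.
move=> approx _ [V Vo <-] [[x0 Px0] /= Vx0].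
have [G PG Gx0] := set_mem Px0.
have /nbhs_ballP[e /= e0 eV] : nbhs x0 V by exact: open_nbhs_nbhs.
have [r re] := exp2V_lt e0.
have [H [PH GH [s Hs]]] := approx G r PG.
(* The interior ensures openness and still contains the centre. *)
pose B : set (rooted_graphs R D) := (ball (iso_class R H) (2 ^- s : R))°.
have s0 : 0 < 2 ^- s :> R by rewrite invr_gt0 exprn_gt0.
exists (\val @^-1` (V `&` B)); split.
- exists (V `&` B) => //; apply: openI => //; exact: open_interior.
- have memH : iso_class R H \in [set iso_class R G | G in P].
    by apply: mem_set; exists H.
  exists (SigSub memH); split => /=.
    apply: eV; rewrite ballEmdist /= -Gx0.
    apply: le_lt_trans re; rewrite -[mdist _ _]/(class_dist _ _).
    rewrite class_dist_iso_class; apply: ge_inf; last by exists r.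
    by exists 0 => _ [n _ <-]; rewrite invr_ge0 exprn_ge0.
  by apply: nbhs_singleton; apply: nbhs_interior; exact: nbhsx_ballx.
- by move=> y [].
apply/seteqP; split=> // y [[_ /interior_subset]].
rewrite ballEmdist /= => yH [K noK yK]; apply: noK; apply: Hs.
move: yH; rewrite -yK -[mdist _ _]/(class_dist _ _) class_dist_iso_class.
exact: rgraph_dist_lt.
Qed.

(** * The finite graphs hung in the odd regular case *)

(* The complement of the disjoint union of a path with three vertices, centred
   at [inl None], and of [j.+1] edges. All its [j.*2 + 5] vertices have degree
   [j.*2 + 3], except [inl None] whose degree is one less. *)
Section gadget.
Context (j : nat).

Definition gadget : finType := (option bool + 'I_j.+1 * bool)%type.

Definition gadget_hub : gadget := inl None.

Definition gadget_coadj : rel gadget := fun x y =>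
  match x, y with
  | inl x, inl y => [|| x == y, x == None | y == None]
  | inr (i, _), inr (i', _) => i == i'
  | _, _ => false
  end.

Definition gadget_adj : rel gadget := fun x y => ~~ gadget_coadj x y.

Lemma gadget_adj_sym : symmetric gadget_adj.
Proof.
move=> [x|[i x]] [y|[i' y]] //; rewrite /gadget_adj /=; last by rewrite eq_sym.
by rewrite eq_sym [(x == None) || _]orbC.
Qed.

Lemma gadget_adj_irr : irreflexive gadget_adj.
Proof. by move=> [x|[i x]]; rewrite /gadget_adj /= eqxx. Qed.

(** Complementation joins the two summands completely, so two steps from the hub suffice. *)
Lemma gadget_connect (x : gadget) : connect gadget_adj gadget_hub x.
Proof.
pose y : gadget := inr (ord0, true).
have hy : connect gadget_adj gadget_hub y by exact: connect1.
by case: x => [x|x]; [apply: (connect_trans hy)|]; apply: connect1; case: x.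
Qed.

(** Counted in the complement: [gadget_coadj] is reflexive, so it relates a vertex to two vertices,
    itself included, and the hub to three. *)
Lemma gadget_degree (x : gadget) :
  (#|[set y | gadget_adj x y]%SET| + (x == gadget_hub) = j.*2 + 3)%N.
Proof.
have co : #|[set y | gadget_coadj x y]%SET| = (2 + (x == gadget_hub))%N.
  case: x => [[b|]|[i b]].
  - transitivity #|([set inl (Some b); inl None] : {set gadget})%SET|.
      by apply: eq_card => -[[c|]|[i c]]; rewrite !inE //= eq_sym orbF.
    by rewrite cards2.
  - transitivity #|([set inl z | z : option bool] : {set gadget})%SET|.
      apply: eq_card => -[c|[i c]]; rewrite !inE /= ?orbT ?imset_f//.
      by apply/esym/imsetP => -[].
    by rewrite card_imset ?card_option ?card_bool// => ? ? [].
  - transitivity #|([set inr (i, z) | z : bool] : {set gadget})%SET|.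
      apply: eq_card => -[c|[i' c]]; rewrite !inE /=.
        by apply/esym/imsetP => -[].
      by apply/eqP/imsetP => [<-|[z _ [->]]//]; exists c.
    by rewrite card_imset ?card_bool// => ? ? [].
have -> : [set y | gadget_adj x y]%SET = (~: [set y | gadget_coadj x y])%SET.
  by apply/setP => y; rewrite !inE.
(* Adding [2] turns the left side into the size of a set plus that of its complement. *)
apply: (@addnI 2); rewrite addnCA -co addnC cardsC.
rewrite card_sum card_option card_prod card_ord card_bool muln2 doubleS.
by rewrite addnC !addSn !addnS.
Qed.

(** [None] is the subdividing vertex [m]. For [D = j.*2 + 3] there are [D - 2] copies, which leaves
    two places at [m]. *)
Definition pendant : finType := option ('I_j.*2.+1 * gadget).

Definition pendant_adj : rel pendant := fun x y =>
  match x, y with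
  | Some (i, a), Some (i', b) => (i == i') && gadget_adj a b
  | None, Some (_, a) | Some (_, a), None => a == gadget_hub
  | None, None => false
  end.

Lemma pendant_adj_sym : symmetric pendant_adj.
Proof. by move=> [[i a]|] [[i' b]|] //=; rewrite eq_sym gadget_adj_sym. Qed.

Lemma pendant_adj_irr : irreflexive pendant_adj.
Proof. by move=> [[i a]|] //=; rewrite gadget_adj_irr andbF. Qed.

Lemma pendant_connect (x : pendant) : connect pendant_adj None x.
Proof.
case: x => [[i a]|]; last exact: connect0.
have /connectP[p ap ->] := gadget_connect a.
apply: (connect_trans (y := Some (i, gadget_hub))).
  by apply: connect1; rewrite /= eqxx.
elim: p gadget_hub ap => [|b p IH] c /=; first by move=> _; exact: connect0.
move=> /andP[cb /IH]; apply: connect_trans.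
by apply: connect1; rewrite /= eqxx.
Qed.

(** The edge to [None] supplies the degree missing at each hub. *)
Lemma pendant_degree (x : pendant) :
  (#|[set y | pendant_adj x y]%SET| + (x == None).*2 = j.*2 + 3)%N.
Proof.
case: x => [[i a]|] /=.
  rewrite addn0 -(gadget_degree a) (cardsD1 None) inE /= addnC; congr addn.
  rewrite -(card_imset (f := fun b => Some (i, b) : pendant)); last first.
    by move=> b c [].
  apply: eq_card => -[[i' b]|]; rewrite !inE /=; last first.
    by apply/esym/imsetP => -[].
  apply/andP/imsetP => [[/eqP <- ab]|[c + [-> ->]]]; last by rewrite inE eqxx.
  by exists b; rewrite ?inE.
transitivity
  (#|([set Some (i, gadget_hub) | i : 'I_j.*2.+1] : {set pendant})%SET| + 2)%N.
  congr addn; apply: eq_card => -[[i b]|]; rewrite !inE /=.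
    by apply/eqP/imsetP => [->|[i' _ [_ ->]]//]; exists i.
  by apply/esym/imsetP => -[].
by rewrite card_imset ?card_ord ?addSnnS// => ? ? [].
Qed.

End gadget.

Theorem theorem3p6 (R : realType) :
  (forall D : nat, (3 <= D)%N ->
     @nowhere_dense (infinite_graphs R D)
       [set x | no_one_way_infinite_bridge R D (\val x)]) /\
  (forall D : nat, (3 <= D)%N -> odd D ->
     @nowhere_dense (regular_infinite_graphs R D)
       [set x | no_one_way_infinite_bridge R D (\val x)]).
Proof.
split=> D D3 => [|oD]; apply: nowhere_dense_iso_class => G r.
  (* [true] is the subdividing vertex and [false] the leaf hung at it, which is the finite side of
     the bridge. *)
  move=> Ginf; have [|||||||||H [Hinf _ GH Hs]] := @graft_approx D r G bool
      (fun x y => x != y) true false true [set false]%SET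
      _ _ _ _ _ _ _ _ _ Ginf;
    rewrite ?inE//; last by exists H.
  - by move=> x y; rewrite eq_sym.
  - by move=> x; rewrite eqxx.
  - by case; [exact: connect0|exact: connect1].
  - by move=> c d /set1P -> /eqP; case: d => // _; right.
  (* The subdividing vertex has degree [1 + 2], which is where [3 <= D] enters. *)
  - move=> c; apply: leq_trans D3.
    have -> : [set d | c != d]%SET = [set ~~ c]%SET.
      by apply/setP => d; rewrite !inE; case: c d => -[].
    by rewrite cards1; case: c.
(* Parity matters: in a finite graph with one vertex of degree [D - 1] and all others of degree [D],
   the degree sum is even only if [D] is odd. *)
have [j Dj] : exists j, D = (j.*2 + 3)%N.
  exists (D - 3)./2; have := odd_double_half (D - 3).
  by rewrite oddB//= oD /= add0n => ->; rewrite subnK.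
(* One bridge is enough: the finite side is the copy of index [ord0], attached by its hub. *)
move=> [Ginf Greg]; have [|||||||||H [Hinf Hreg GH Hs]] := @graft_approx D r G
    (pendant j) (@pendant_adj j) None (Some (ord0, gadget_hub j)) None
    [set Some (ord0, a) | a : gadget j]%SET _ _ _ _ _ _ _ _ _ Ginf.
- exact: pendant_adj_sym.
- exact: pendant_adj_irr.
- exact: pendant_connect.
- exact: imset_f.
- by apply/imsetP => -[].
- by apply/imsetP => -[].
- by rewrite /= eqxx.
- move=> c [[i b]|] /imsetP[a _ ->] /=.
    by move=> /andP[/eqP <- _]; left; exact: imset_f.
  by move=> /eqP ->; right.
- by move=> c; rewrite pendant_degree -Dj.
exists H; split=> //; split=> //; apply: Hreg => // c.
by rewrite pendant_degree -Dj.
Qed.
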